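(* Let $n\ge2$, $v\in\mathbb{Z}$, $u,w\ge0$ integers, and $\mathbf{x}=(x_0,\dots,x_{k_{\mathbf{x}}})\in\mathcal{L}_v$. Then $$|\eta_{u,v,w}(\mathbf{x})|=\begin{cases}\|\mathbf{x}\|_1+u+w & \text{if } k_{\mathbf{x}}\le\max(u,w),\\ \|\mathbf{x}\|_1+2k_{\mathbf{x}}-|u-w| & \text{otherwise.}\end{cases}$$
   Context: $\mathbb{N}=\{0,1,2,\dots\}$. For a finitely supported integer sequence $\mathbf{x}=(x_0,x_1,\dots)\in\bigoplus_{i\in\mathbb{N}}\mathbb{Z}$ put $\Sigma(\mathbf{x})=\sum_i x_in^i$, and for $v\in\mathbb{Z}$ let $\mathcal{L}_v=\{\mathbf{x}:\Sigma(\mathbf{x})=v\}$. Let $\|\mathbf{x}\|_1=\sum_i|x_i|$ and let $k_{\mathbf{x}}$ be the index of the last nonzero coordinate of $\mathbf{x}$ (with $k_{\mathbf{0}}=0$). For $u,w\in\mathbb{N}$, $v\in\mathbb{Z}$ and $\mathbf{x}\in\mathcal{L}_v$, writing $k=k_{\mathbf{x}}$, define the word $\eta_{u,v,w}(\mathbf{x})$ in $a^{\pm1},t^{\pm1}$ (it represents the element $t^{-u}a^vt^w$ of $BS(1,n)=\langle t,a\mid tat^{-1}=a^n\rangle$) by - $t^{-u}a^{x_0}ta^{x_1}\cdots ta^{x_k}t^{w-k}$ if $k\le w$ (shape 1) or if $u\le w<k$ (shape 3); - $t^{k-u}a^{x_k}t^{-1}a^{x_{k-1}}\cdots t^{-1}a^{x_0}t^{w}$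 if $w<k\le u$ (shape 2) or if $w<u<k$ (shape 4). $|\cdot|$ denotes the length of the word as written (sum of absolute values of exponents, no cancellation), not the word length of the group element. *)

(* Defs.v *)
From HB Require Import structures.
From mathcomp Require Import all_boot all_order all_algebra.
From mathcomp Require Import finmap.

Set Implicit Arguments.
Unset Strict Implicit.
Unset Printing Implicit Defensive.

Import Order.TTheory GRing.Theory Num.Theory.
Local Open Scope ring_scope.

Notation intseq := {fsfun nat -> int with 0}.

Definition Sigma (n : nat) (x : intseq) : int :=
  \sum_(i <- finsupp x) x i * n%:Z ^+ i.

Definition Lset (n : nat) (v : int) : pred intseq :=
  [pred x | Sigma n x == v].

Definition l1norm (x : intseq) : int := \sum_(i <- finsupp x) `|x i|.

(* The empty maximum is 0, which gives the convention [last_index 0 = 0]. *)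
Definition last_index (x : intseq) : nat := \max_(i <- finsupp x) i.

Inductive bsgen := gen_a | gen_t.

(* The letter [(g, true)] is [g^-1].  A word is never freely reduced, so its
   length as written, i.e. the sum of the absolute values of its exponents, is
   [size]. *)
Definition letter := (bsgen * bool)%type.
Definition word := seq letter.

Definition gpow (g : bsgen) (m : int) : word := nseq `|m|%N (g, m < 0).

(* t^-u a^(x_0) t a^(x_1) ... t a^(x_k) t^(w-k) *)
Definition word_up (u w : nat) (x : intseq) : word :=
  let k := last_index x in
  gpow gen_t (- u%:Z) ++ gpow gen_a (x 0%N)
    ++ flatten [seq gpow gen_t 1 ++ gpow gen_a (x i) | i <- iota 1 k]
    ++ gpow gen_t (w%:Z - k%:Z).

(* t^(k-u) a^(x_k) t^-1 a^(x_(k-1)) ... t^-1 a^(x_0) t^w *)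
Definition word_down (u w : nat) (x : intseq) : word :=
  let k := last_index x in
  gpow gen_t (k%:Z - u%:Z) ++ gpow gen_a (x k)
    ++ flatten [seq gpow gen_t (-1) ++ gpow gen_a (x i) | i <- rev (iota 0 k)]
    ++ gpow gen_t w%:Z.

(* The word eta_{u,v,w}(x) for x in L_v.  Its spelling depends on v only through
   x.  The first test is shape 1 or shape 3; its negation, w < k and w < u, is
   shape 2 (w < k <= u) or shape 4 (w < u < k). *)
Definition eta_word (u : nat) (v : int) (w : nat) (x : intseq) : word :=
  let k := last_index x in
  if ((k <= w) || (u <= w < k))%N then word_up u w x else word_down u w x.

(* Main.v *)
Require Import Defs.
From HB Require Import structures.
From mathcomp Require Import all_boot all_order all_algebra.
From mathcomp Require Import finmap.
From mathcomp Require Import zify.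

(** Every coordinate [x i] with [i] at most [k = last_index x] is spelled
    exactly once, so in either spelling the letters [a^(+-1)] contribute the l1-norm
    and the [k] separators [t^(+-1)] contribute [k].  The initial and final powers
    of [t] contribute [u + |w - k|] when the indices increase and [|k - u| + w]
    when they decrease.  Hence the length is [l1norm x + k + u + |w - k|] or
    [l1norm x + k + |k - u| + w], and resolving the absolute values in each of
    the four shapes gives the formula: the increasing spelling is used for
    [k > w] only if [u <= w], the decreasing one only if [w < u] and [w < k], so
    the sign of [u - w] is known whenever [k] exceeds both [u] and [w].
    The lemma [size_blocks] counts the separated blocks, and [l1norm_range]
    identifies the sum over the support with the sum over all indices up to
    [k]. *)

Set Implicit Arguments.
Unset Strict Implicit.
Unset Printing Implicit Defensive.

Import Order.TTheory GRing.Theory Num.Theory.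
Local Open Scope ring_scope.

Lemma size_gpow (g : bsgen) (m : int) : size (gpow g m) = `|m|%N.
Proof. by rewrite size_nseq. Qed.

(** The list of indices is arbitrary so that both the increasing and the
    decreasing spellings are instances. *)
Lemma size_blocks (e : int) (x : nat -> int) (s : seq nat) :
  size (flatten [seq gpow gen_t e ++ gpow gen_a (x i) | i <- s])
  = (`|e| * size s + \sum_(i <- s) `|x i|)%N.
Proof.
elim: s => [|i s IHs] /=; first by rewrite big_nil muln0.
by rewrite big_cons !size_cat IHs !size_gpow mulnS addnACA.
Qed.

(** Coordinates outside the support vanish, so padding the sum with every index
    up to the last one changes nothing. *)
Lemma l1norm_range (x : intseq) :
  l1norm x = (\sum_(i <- iota 0 (last_index x).+1) `|x i|)%N%:Z.
Proof.
have supp_filter :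
    perm_eq (finsupp x) [seq i <- iota 0 (last_index x).+1 | i \in finsupp x].
  apply: uniq_perm => [||i]; rewrite ?filter_uniq ?iota_uniq ?fset_uniq //.
  rewrite mem_filter mem_iota add0n ltnS leq0n andTb.
  by apply/esym/andb_idr => xi; apply: leq_bigmax_seq.
rewrite /l1norm (perm_big _ supp_filter) big_filter big_mkcond.
rewrite (big_morph Posz PoszD (erefl (Posz 0))); apply: eq_bigr => i _.
by case: finsuppP => // _; rewrite abszE.
Qed.

Lemma size_word_up (u w : nat) (x : intseq) :
  (size (word_up u w x))%:Z =
    l1norm x + (last_index x)%:Z + u%:Z + `|w%:Z - (last_index x)%:Z|.
Proof.
rewrite l1norm_range /= big_cons /word_up !size_cat !size_gpow size_blocks size_iota.
lia.
Qed.

Lemma size_word_down (u w : nat) (x : intseq) :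
  (size (word_down u w x))%:Z =
    l1norm x + (last_index x)%:Z + `|(last_index x)%:Z - u%:Z| + w%:Z.
Proof.
rewrite l1norm_range -addn1 iotaD big_cat big_seq1 add0n /=.
rewrite /word_down !size_cat !size_gpow size_blocks size_rev size_iota.
rewrite (perm_big (iota 0 (last_index x))) ?perm_rev //=.
lia.
Qed.

Theorem lemma3p7 (n : nat) (hn : (2 <= n)%N) (v : int) (u w : nat)
    (x : {fsfun nat -> int with 0}) (hx : x \in Lset n v) :
  (size (eta_word u v w x))%:Z =
    if (last_index x <= maxn u w)%N
    then l1norm x + u%:Z + w%:Z
    else l1norm x + 2 * (last_index x)%:Z - `|u%:Z - w%:Z|.
Proof.
rewrite /eta_word; case: ifP => shape; case: ifP => k_max;
  rewrite ?size_word_up ?size_word_down; lia.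
Qed.
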